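(* Let $n\geq 1$. There exists $X\in(\mathbb{Z}/2\mathbb{Z})^n$ such that the Delannoy--Steinhaus triangle $D(X)$ is balanced if and only if $n+1$ is a perfect square. More precisely, if $n+1=q^2$ with $q$ a positive integer, then for $X\in(\mathbb{Z}/2\mathbb{Z})^n$ the triangle $D(X)$ is balanced if and only if the number $z$ of zeros in the prefix-parity sequence of $X$ satisfies \[ z=\frac{q^2-q}{2}\qquad\text{or}\qquad z=\frac{q^2+q}{2}. \] The number of binary sequences of length $n$ generating a balanced triangle is therefore \[ \#\{X\in(\mathbb{Z}/2\mathbb{Z})^n:D(X)\text{ is balanced}\}= \begin{cases} \displaystyle\binom{n+1}{\frac{n+1-\sqrt{n+1}}{2}}, & \text{if } n+1 \text{ is a perfect square},\\[3mm] 0, & \text{otherwise}. \end{cases} \] Equivalently, when $n+1=q^2$, this number is $\binom{q^2}{(q^2-q)/2}$.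
   Context: For $X=(a_0,\ldots,a_{n-1})\in(\mathbb{Z}/2\mathbb{Z})^n$, the (binary) Delannoy--Steinhaus triangle $D(X)=(a_{i,j})$ is defined for $0\leq i\leq n-1$ and $0\leq j\leq n-i-1$ by $a_{0,j}=a_j$ and, in $\mathbb{Z}/2\mathbb{Z}$, \[ a_{1,j}=a_{0,j}+a_{0,j+1}\quad(0\leq j\leq n-2), \] \[ a_{i+1,j}=a_{i,j}+a_{i,j+1}+a_{i-1,j+1}\quad(1\leq i\leq n-2,\ 0\leq j\leq n-i-2). \] The triangle $D(X)$ is called balanced when it contains (over all rows, including row $0$) equally many entries equal to $0$ and entries equal to $1$. The prefix-parity sequence of $X$ is $P=(P_0,\ldots,P_n)\in(\mathbb{Z}/2\mathbb{Z})^{n+1}$ with $P_0=0$ and $P_r=\sum_{h=0}^{r-1}a_h \pmod 2$ for $1\leq r\leq n$. *)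

(* Defs.v *)
From Stdlib Require PeanoNat.
From mathcomp Require Import all_boot all_order all_algebra.

Set Implicit Arguments.
Unset Strict Implicit.
Unset Printing Implicit Defensive.

Import GRing.Theory.
Local Open Scope ring_scope.

(* The recurrence is run on a sequence indexed by all of nat, so that no index
   bounds occur in it; the entry (i, j) only depends on a_j, ..., a_(i+j). *)
Fixpoint delannoy_entry (a : nat -> 'Z_2) (i j : nat) {struct i} : 'Z_2 :=
  match i with
  | 0%N => a j
  | i'.+1 =>
    match i' with
    | 0%N => a j + a j.+1
    | i''.+1 => delannoy_entry a i' j + delannoy_entry a i' j.+1
                + delannoy_entry a i'' j.+1
    end
  end.

(* X`_j is 0 for j >= n, but these values do not occur when i + j < n. *)
Definition DS_entry (n : nat) (X : n.-tuple 'Z_2) (i j : nat) : 'Z_2 :=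
  delannoy_entry (fun k => X`_k) i j.

Definition DS_positions (n : nat) : {set 'I_n * 'I_n} :=
  [set p : 'I_n * 'I_n | (p.1 + p.2 < n)%N].

Definition DS_count (n : nat) (X : n.-tuple 'Z_2) (v : 'Z_2) : nat :=
  #|[set p in DS_positions n | DS_entry X p.1 p.2 == v]|.

Definition balanced (n : nat) (X : n.-tuple 'Z_2) : bool :=
  DS_count X 0 == DS_count X 1.

Definition prefix_parity (n : nat) (X : n.-tuple 'Z_2) (r : nat) : 'Z_2 :=
  \sum_(0 <= h < r) X`_h.

Definition prefix_zeros (n : nat) (X : n.-tuple 'Z_2) : nat :=
  #|[set r : 'I_n.+1 | prefix_parity X r == 0]|.

(* The bound q <= m is harmless: see perfect_squareP. *)
Definition perfect_square (m : nat) : bool := [exists q : 'I_m.+1, m == (q ^ 2)%N].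

Lemma perfect_squareP (m : nat) :
  reflect (exists q : nat, m = (q ^ 2)%N) (perfect_square m).
Proof.
apply: (iffP existsP) => [[q /eqP mq] | [q mq]]; first by exists q.
have ltqm : (q < m.+1)%N.
  by rewrite ltnS mq; case: (q) => // k; rewrite expnS expn1 leq_pmulr.
by exists (Ordinal ltqm); apply/eqP.
Qed.

(* Nat.sqrt is the integer part of the square root, hence exact on squares. *)
Lemma Nat_sqrt_square (q : nat) : Nat.sqrt (q ^ 2)%N = q.
Proof. by rewrite expnS expn1; exact: PeanoNat.Nat.sqrt_square. Qed.

(* Main.v *)
Require Import Defs.
From mathcomp Require Import all_boot all_order all_algebra.
From mathcomp Require Import zify.

(** Let [N = n + 1] and let [P_0, ..., P_n] be the prefix parities of [X].

    Over the field with two elements, with [x] the shift of sequences, the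
    recurrence of the triangle has characteristic polynomial
    [t^2 + (1 + x) t + x = (t + 1)(t + x)], which together with the first two
    rows makes row [i] the image of row 0 under [1 + x + ... + x^i].  The entry
    [(i, j)] is therefore a sum of [i + 1] consecutive letters of [X], that is
    [P_j + P_(i + j + 1)] ([DS_entryE]).  As [(i, j)] runs over the triangle,
    [(j, i + j + 1)] runs over the pairs [r < s] of indices of [P], so the
    triangle lists, once for each pair of indices, whether the two prefix
    parities agree ([DS_count_pairs]).

    If [z] of the prefix parities vanish, there are [z (N - z)] disagreeing
    pairs among [N (N - 1) / 2], and equality of the numbers of agreeing and
    disagreeing pairs reads [(2 z - N)^2 = N] ([balancedE]).  So [N] is a
    square [q^2] and [2 z = q^2 - q] or [2 z = q^2 + q].

    For the enumeration, a word [X] amounts to a set of indices of [P] up to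
    complementation: the set where [P] vanishes, or the one where it does not.
    The two solutions for [z] add up to [N], so a word is balanced exactly when
    one of its two sets has [(q^2 - q) / 2] elements, and only one of them has
    because [q > 0].  Balanced words thus correspond to the subsets of that
    cardinality of a set with [q^2] elements ([card_balanced]). *)

Set Implicit Arguments.
Unset Strict Implicit.
Unset Printing Implicit Defensive.

Import GRing.Theory.

(** * Arithmetic modulo two *)

Lemma addZ2xx (x : 'Z_2) : (x + x = 0)%R.
Proof. by case: x => [[|[|k]] lt_k2] //; apply/val_inj. Qed.

Lemma addZ2_eq0 (x y : 'Z_2) : (x + y == 0)%R = (x == y).
Proof. by rewrite addr_eq0 -[in RHS](addrK y y) addZ2xx sub0r. Qed.

Lemma Z2_eq1 (x : 'Z_2) : (x == 1%R) = (x != 0%R).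
Proof. by case: x => [[|[|k]] lt_k2]. Qed.

(** * Entries of the triangle as sums of two prefix parities *)

(** The recurrence adds the sums over the windows [j .. j + i + 1] and
    [j + 1 .. j + i + 2] and the sum over their intersection; modulo two, this
    is the sum over their union. *)
Lemma delannoy_entryE (a : nat -> 'Z_2) (i j : nat) :
  delannoy_entry a i j = (\sum_(j <= h < (i + j).+1) a h)%R.
Proof.
elim/ltn_ind: i j => -[|[|i]] IH j; first by rewrite /= big_nat1.
  by rewrite /= add1n big_nat_recr // big_nat1.
rewrite [LHS]/= -/(delannoy_entry a i.+1 j) -/(delannoy_entry a i.+1 j.+1).
rewrite !IH // !addSn addnS.
rewrite [RHS]big_nat_recr /=; last by lia.
rewrite [X in (_ + X + _)%R]big_nat_recr /=; last by lia.
by rewrite -!addrA; congr (_ + _)%R; rewrite addrCA addZ2xx addr0.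
Qed.

Lemma DS_entryE n (X : n.-tuple 'Z_2) (i j : nat) :
  DS_entry X i j = (prefix_parity X j + prefix_parity X (i + j).+1)%R.
Proof.
rewrite /DS_entry delannoy_entryE /prefix_parity.
rewrite (@big_cat_nat _ _ _ j 0 (i + j).+1) //=; last by lia.
by rewrite addrA addZ2xx add0r.
Qed.

(** [(i, j) |-> (j, i + j + 1)] maps the positions of the triangle bijectively
    onto the increasing pairs of indices of the prefix parities. *)
Lemma DS_count_pairs n (X : n.-tuple 'Z_2) (v : 'Z_2) :
  DS_count X v =
  #|[set p : 'I_n.+1 * 'I_n.+1 |
      (p.1 < p.2) && (prefix_parity X p.1 + prefix_parity X p.2 == v)%R]|.
Proof.
pose f (p : 'I_n * 'I_n) : 'I_n.+1 * 'I_n.+1 :=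
  (widen_ord (leqnSn n) p.2, inord (p.1 + p.2).+1).
rewrite /DS_count -(card_in_imset (f := f)); last first.
  move=> [i j] [i' j']; rewrite !inE /= => /andP[lt_ij _] /andP[lt_ij' _] [] ej.
  move=> /(congr1 (@nat_of_ord _)); rewrite !inordK ?ltnS // => eij.
  by congr pair; apply/val_inj => /=; lia.
apply: eq_card => -[r s]; apply/imsetP/idP => [[[i j]]|].
  rewrite !inE /= => /andP[lt_ij]; rewrite DS_entryE => eij [-> ->] /=.
  by rewrite inordK ?ltnS // leq_addl.
rewrite inE /= => /andP[lt_rs ers].
have lt_i : s - r.+1 < n by have := ltn_ord s; lia.
have lt_r : r < n by have := ltn_ord s; lia.
have es : (s - r.+1 + r).+1 = s by lia.
exists (Ordinal lt_i, Ordinal lt_r).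
  rewrite !inE /= DS_entryE es ers andbT; have := ltn_ord s; lia.
by congr pair; apply/val_inj; rewrite //= inordK es.
Qed.

(** * Counting pairs of indices *)

(** It reduces counting increasing pairs to counting ordered pairs of distinct
    indices, which are easily arranged in cartesian products. *)
Lemma card_sym_rel N (R : rel 'I_N) : symmetric R ->
  #|[set p | (p.1 != p.2) && R p.1 p.2]| =
  #|[set p : 'I_N * 'I_N | (p.1 < p.2) && R p.1 p.2]|.*2.
Proof.
move=> symR; set U := [set p : 'I_N * 'I_N | (p.1 < p.2) && R p.1 p.2].
pose swap (p : 'I_N * 'I_N) := (p.2, p.1).
have swap_inj : injective swap by move=> [? ?] [? ?] [-> ->].
have swapE p : (p \in swap @: U) = (swap p \in U).
  by case: p => r s; rewrite -[RHS](mem_imset _ _ swap_inj).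
rewrite -addnn -{2}(card_imset U swap_inj) -cardsUI.
rewrite [X in _ + X](_ : _ = 0); last first.
  apply/eqP; rewrite cards_eq0 -subset0; apply/subsetP => -[r s].
  rewrite in_setI swapE !inE /=; lia.
rewrite addn0; apply: eq_card => -[r s].
rewrite in_setU swapE !inE /= [R s r]symR -andb_orl.
by rewrite -neq_ltn.
Qed.

Definition zero_set n (X : n.-tuple 'Z_2) : {set 'I_n.+1} :=
  [set r : 'I_n.+1 | prefix_parity X r == 0%R].

Lemma card_zero_setC n (X : n.-tuple 'Z_2) :
  #|~: zero_set X| = n.+1 - prefix_zeros X.
Proof. by rewrite cardsCs setCK card_ord. Qed.

Lemma prefix_zeros_le n (X : n.-tuple 'Z_2) : prefix_zeros X <= n.+1.
Proof. by rewrite -[leqRHS]card_ord max_card. Qed.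

Lemma zero_set_eq n (X : n.-tuple 'Z_2) (r s : 'I_n.+1) :
  (prefix_parity X r == prefix_parity X s) =
  ((r \in zero_set X) == (s \in zero_set X)).
Proof.
rewrite !inE.
by case: (prefix_parity X r) (prefix_parity X s) => [[|[|?]] ?] [[|[|?]] ?].
Qed.

Lemma DS_count0 n (X : n.-tuple 'Z_2) :
  (DS_count X 0%R).*2 + n.+1 =
  prefix_zeros X ^ 2 + (n.+1 - prefix_zeros X) ^ 2.
Proof.
rewrite DS_count_pairs.
rewrite (eq_card (B := [set p : 'I_n.+1 * 'I_n.+1 | (p.1 < p.2) &&
   ((p.1 \in zero_set X) == (p.2 \in zero_set X))])); last first.
  by move=> p; rewrite !inE addZ2_eq0 zero_set_eq !inE.
rewrite -(card_sym_rel
  (R := fun r s => (r \in zero_set X) == (s \in zero_set X))); last first.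
  by move=> r s; rewrite eq_sym.
(* With the [n + 1] diagonal pairs added, the agreeing ordered pairs are those
   of the square of the zero set and of the square of its complement. *)
have diag_inj : injective (fun r : 'I_n.+1 => (r, r)) by move=> r s [].
rewrite -[X in _ + X]card_ord -(card_imset _ diag_inj) -cardsUI.
have mem_diag (p : 'I_n.+1 * 'I_n.+1) :
    (p \in [set (r, r) | r : 'I_n.+1]) = (p.1 == p.2).
  by apply/imsetP/eqP => [[r _ ->] | ]; last by case: p => r s /= ->; exists s.
rewrite [X in _ + X](_ : _ = 0); last first.
  apply/eqP; rewrite cards_eq0 -subset0; apply/subsetP => p.
  by rewrite in_setI mem_diag !inE; case: eqP; rewrite ?andbF.
rewrite addn0 -card_zero_setC -!mulnn -!cardsX -cardsUI.
rewrite [X in _ = _ + X](_ : _ = 0) ?addn0; last first.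
  apply/eqP; rewrite cards_eq0 -subset0; apply/subsetP => -[r s].
  by rewrite !inE /=; case: (prefix_parity X r == _); rewrite ?andbF.
apply: eq_card => -[r s]; rewrite in_setU mem_diag !inE /=.
have [->|_] /= := eqVneq r s; first by case: (prefix_parity X s == _).
by case: (prefix_parity X r == _); case: (prefix_parity X s == _).
Qed.

Lemma DS_count1 n (X : n.-tuple 'Z_2) :
  DS_count X 1%R = prefix_zeros X * (n.+1 - prefix_zeros X).
Proof.
apply: double_inj; rewrite DS_count_pairs.
rewrite (eq_card (B := [set p : 'I_n.+1 * 'I_n.+1 | (p.1 < p.2) &&
   ((p.1 \in zero_set X) != (p.2 \in zero_set X))])); last first.
  by move=> p; rewrite !inE Z2_eq1 addZ2_eq0 zero_set_eq !inE.
rewrite -(card_sym_rel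
  (R := fun r s => (r \in zero_set X) != (s \in zero_set X))); last first.
  by move=> r s; rewrite eq_sym.
rewrite -addnn -{2}[_ * _]mulnC -card_zero_setC -!cardsX -cardsUI.
rewrite [X in _ = _ + X](_ : _ = 0) ?addn0; last first.
  apply/eqP; rewrite cards_eq0 -subset0; apply/subsetP => -[r s].
  by rewrite !inE /=; case: (prefix_parity X r == _); rewrite ?andbF.
apply: eq_card => -[r s]; rewrite !inE /=.
have [->|_] /= := eqVneq r s; first by case: (prefix_parity X s == _).
by case: (prefix_parity X r == _); case: (prefix_parity X s == _).
Qed.

(** * The balance equation *)

(** The sum of the two truncated differences is the distance from [2 z] to
    [n + 1]; writing it out keeps the equation within the naturals. *)
Lemma balancedE n (X : n.-tuple 'Z_2) (z := prefix_zeros X) :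
  balanced X = ((z.*2 - n.+1 + (n.+1 - z.*2)) ^ 2 == n.+1).
Proof.
rewrite /balanced; have := DS_count0 X; have := DS_count1 X.
have := prefix_zeros_le X; rewrite -/z.
move: (DS_count _ _) (DS_count _ _) z => c1 c0 z le_z -> e.
have [u eu] : exists u, n.+1 = z + u by exists (n.+1 - z); lia.
rewrite eu addKn in e *.
have [le_uz | /ltnW le_zu] := leqP u z.
  have [k ek] : exists k, z = u + k by exists (z - u); lia.
  have -> : z.*2 - (z + u) + (z + u - z.*2) = k by lia.
  by move: e; rewrite ek -!mulnn => e; apply/eqP/eqP; nia.
have [k ek] : exists k, u = z + k by exists (u - z); lia.
have -> : z.*2 - (z + u) + (z + u - z.*2) = k by lia.
by move: e; rewrite ek -!mulnn => e; apply/eqP/eqP; nia.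
Qed.

(** The halves in the solutions are exact because [q (q - 1)] is even. *)
Lemma double_half_pronic q :
  ((q ^ 2 - q) %/ 2).*2 + q = q ^ 2 /\
  (q ^ 2 + q) %/ 2 = (q ^ 2 - q) %/ 2 + q.
Proof.
have [k ek] : exists k, q ^ 2 = k.*2 + q.
  exists 'C(q, 2); elim: q => // q IH; rewrite binS bin1; nia.
rewrite ek; split; lia.
Qed.

Lemma balanced_square n (X : n.-tuple 'Z_2) (q : nat) : n.+1 = q ^ 2 ->
  balanced X <->
  prefix_zeros X = (q ^ 2 - q) %/ 2 \/ prefix_zeros X = (q ^ 2 + q) %/ 2.
Proof.
move=> en; rewrite balancedE en eqn_exp2r //.
have [ew ->] := double_half_pronic q.
split=> [/eqP|] ?; [lia | apply/eqP; lia].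
Qed.

(** * Words and sets of prefix indices *)

(** A word is recovered from its zero set by adding adjacent prefix parities;
    since only differences matter, the complement gives the same word. *)
Definition boundary n (A : {set 'I_n.+1}) : n.-tuple 'Z_2 :=
  [tuple (((inord i \in A) (+) (inord i.+1 \in A) : nat)%:R)%R | i < n].

Lemma natr_addb (b c : bool) : ((b (+) c)%:R = b%:R + c%:R :> 'Z_2)%R.
Proof. by case: b; case: c; apply/val_inj. Qed.

(** The sum telescopes; [ord0 \in A] appears because prefix parities start with
    zero, which settles the choice between [A] and its complement. *)
Lemma prefix_parity_boundary n (A : {set 'I_n.+1}) (r : 'I_n.+1) :
  prefix_parity (boundary A) r = (((ord0 \in A) (+) (r \in A))%:R)%R.
Proof.
rewrite -[in RHS](inord_val r) -[ord0](inord_val ord0) /=.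
have: r <= n by rewrite -ltnS.
rewrite /prefix_parity; elim: {r}(r : nat) => [|r IH] lt_rn.
  by rewrite big_nil addbb.
rewrite big_nat_recr //= IH; last exact: ltnW.
rewrite (nth_mktuple _ _ (Ordinal lt_rn)) /= -natr_addb.
by rewrite -addbA (addbA (_ \in A) _ (inord r.+1 \in A)) addbb.
Qed.

Lemma zero_set_boundary n (A : {set 'I_n.+1}) :
  zero_set (boundary A) = if ord0 \in A then A else ~: A.
Proof.
apply/setP => r; rewrite inE prefix_parity_boundary.
by case: ifP; rewrite ?inE; case: (r \in A).
Qed.

Lemma boundaryC n (A : {set 'I_n.+1}) : boundary (~: A) = boundary A.
Proof.
by apply: eq_from_tnth => i; rewrite !tnth_mktuple !inE addNb addbN negbK.
Qed.

Lemma boundary_zero_set n (X : n.-tuple 'Z_2) : boundary (zero_set X) = X.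
Proof.
apply: eq_from_tnth => i.
rewrite tnth_mktuple !inE !inordK ?ltnS //; last exact: ltnW.
rewrite {2}/prefix_parity big_nat_recr //= -/(prefix_parity X i) -tnth_nth.
by case: (prefix_parity X i) (tnth X i) => [[|[|?]] ?] [[|[|?]] ?] //;
  apply/val_inj.
Qed.

(** [boundary] sends the sets of [(q^2 - q) / 2] indices bijectively to the
    balanced words, the preimage of a word being its zero set or the complement
    of it, whichever has the right cardinality. *)
Lemma card_balanced n q : 0 < q -> n.+1 = q ^ 2 ->
  #|[set X : n.-tuple 'Z_2 | balanced X]| = 'C(q ^ 2, (q ^ 2 - q) %/ 2).
Proof.
move=> q_gt0 en; set w := (q ^ 2 - q) %/ 2.
have [ew ew'] := double_half_pronic q; rewrite -/w in ew ew'.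
have cardC (A : {set 'I_n.+1}) : #|~: A| = q ^ 2 - #|A|.
  by rewrite -en cardsCs setCK card_ord.
rewrite -en -[X in 'C(X, _)](card_ord n.+1) -card_draws.
rewrite -(card_in_imset (f := @boundary n)); last first.
  move=> A B; rewrite !inE => /eqP cA /eqP cB /(congr1 (@zero_set n)).
  rewrite !zero_set_boundary.
  case: ifP => _; case: ifP => _ // eAB; last exact: setC_inj.
    (* The two sets would be complementary, but [w] is not half of [q ^ 2]. *)
    by have := cardC B; rewrite -eAB cA cB; lia.
  by have := cardC A; rewrite eAB cA cB; lia.
apply: eq_card => X; rewrite inE; apply/idP/imsetP => [|[A]].
  case/(balanced_square X en) => cX.
    by exists (zero_set X); rewrite ?boundary_zero_set // inE; apply/eqP.
  exists (~: zero_set X); rewrite ?boundaryC ?boundary_zero_set //.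
  by rewrite inE cardC [#|_|]cX ew'; apply/eqP; lia.
rewrite inE => /eqP cA ->; apply/(balanced_square _ en).
rewrite -[prefix_zeros _]/#|zero_set (boundary A)| zero_set_boundary.
by case: ifP => _; [left | right; rewrite cardC cA ew'; lia].
Qed.

Theorem corollary4p2 (n : nat) (n_ge1 : 1 <= n) :
  [/\ (exists X : n.-tuple 'Z_2, balanced X) <-> perfect_square n.+1,
      forall q : nat, 0 < q -> n.+1 = q ^ 2 ->
        forall X : n.-tuple 'Z_2,
          balanced X <->
          prefix_zeros X = (q ^ 2 - q) %/ 2 \/ prefix_zeros X = (q ^ 2 + q) %/ 2,
      #|[set X : n.-tuple 'Z_2 | balanced X]| =
        (if perfect_square n.+1 then 'C(n.+1, (n.+1 - Nat.sqrt n.+1) %/ 2) else 0)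
    & forall q : nat, 0 < q -> n.+1 = q ^ 2 ->
        #|[set X : n.-tuple 'Z_2 | balanced X]| = 'C(q ^ 2, (q ^ 2 - q) %/ 2)].
Proof.
have squareP : reflect (exists2 q, 0 < q & n.+1 = q ^ 2) (perfect_square n.+1).
  apply: (iffP (perfect_squareP _)) => [[q en] | [q _ en]]; last by exists q.
  by exists q => //; case: q en.
have balanced_perfect (X : n.-tuple 'Z_2) : balanced X -> perfect_square n.+1.
  rewrite balancedE => /eqP en; apply/perfect_squareP.
  by eexists; symmetry; exact: en.
split; last by move=> q; apply: card_balanced.
- split=> [[X /balanced_perfect//] | /squareP[q q_gt0 en]].
  suff /card_gt0P[X] : 0 < #|[set X : n.-tuple 'Z_2 | balanced X]|.
    by rewrite inE; exists X.
  rewrite (card_balanced q_gt0 en) bin_gt0.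
  by have [ew _] := double_half_pronic q; lia.
- by move=> q _ en X; apply: balanced_square.
- case: (squareP) => [[q q_gt0 en] | not_square].
    by rewrite (card_balanced q_gt0 en) en Nat_sqrt_square.
  apply/eqP; rewrite cards_eq0 -subset0; apply/subsetP => X.
  by rewrite inE => /balanced_perfect/squareP.
Qed.
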